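(* Let $\mathcal{G}=(V,E)$ be a connected simple graph. Let $\mathcal{F}_2$ be the set of all periodic traversing policies (routes) obtained from the duplicated edge scheme, i.e. the routes in $\mathcal{G}$ that follow an Eulerian cycle of the multigraph $\mathcal{G}'$ obtained from $\mathcal{G}$ by duplicating every edge. Let $R_1^*$ and $R^*$ denote the optimal policies (those minimizing the time-average AoI) within the policy sets $\mathcal{F}_1$ and $\mathcal{F}$, respectively, and let $E_1^*\subseteq E$ be the set of edges that are traversed once under $R_1^*$. Then for all routes $R_2\in\mathcal{F}_2$, $$\frac{\overline{\Delta}(\mathcal{G};R_2)}{\overline{\Delta}(\mathcal{G};R_1^* )}\le \frac{l(E)^2}{\frac12 l(E)^2+\frac14 l(E_1^* )\,\bigl(l(E)-l(E_1^* )\bigr)}\le 2$$ and $$\frac{\overline{\Delta}(\mathcal{G};R_2)}{\overline{\Delta}(\mathcal{G};R^* )}\le 2 .$$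
   Context: $\mathcal{G}=(V,E)$ is a connected simple graph with finitely many nodes; each edge $e$ is regarded as a segment of positive length $l(e)$, and $l(F)=\sum_{e\in F}l(e)$ for $F\subseteq E$. Policies: a single UAV moves along the edges at unit speed and must patrol all the edges. $\mathcal{F}$ is the set of patrol policies under which all edges are traversed by the UAV without changing direction halfway along an edge and the UAV never halts while traversing; policies in $\mathcal{F}$ may be non-periodic. Age: for a point $x$ on an edge, the temporary age at time $t$ is $\Delta(x,t)=t-U(x,t)$, where $U(x,t)$ is the most recent time that $x$ was visited. It is assumed throughout that the temporary age at time $t$ is finite almost everywhere, i.e. the set of points of infinite age has length $0$. The time-average Age of Information (AoI) under policy $\psi$ is $$\overline{\Delta}(\mathcal{G};\psi)=\lim_{T\to\infty}\frac1T\int_0^T\int_{x\in\bigcup_{e\in E} e}\Delta(x,t)\,dx\,dt .$$ Routes: a route is a closed walk $R=(R[0],\dots,R[M])$ in $\mathcal{G}$, $R[0]=R[M]$, traversing every edge at least once and at most twice (in any directions) before returning to the starting node. $\mathcal{F}_1\subset\mathcal{F}$ is the set of periodic policies that repeat a route forever; a route is identified with this policy, and $\overline\Delta(\mathcal{G};R)$ is its AoI. An Eulerian cycle of a multigraph is a closed walk using each edge (counted with multiplicity) exactly once; an Eulerian cycle of $\mathcal{G}'$ is viewed as a route in $\mathcal{G}$, traversing every edge of $\mathcal{G}$ twice. *)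

(* Defs.v *)
(* MathComp + MathComp-Analysis. *)
From HB Require Import structures.
From mathcomp Require Import all_boot all_order all_algebra.
From mathcomp Require Import all_classical all_reals all_analysis.
Set Implicit Arguments.
Unset Strict Implicit.
Unset Printing Implicit Defensive.
Import Order.TTheory GRing.Theory Num.Theory.
Import numFieldNormedType.Exports.
Local Open Scope classical_set_scope.
Local Open Scope ring_scope.

(* Finite undirected multigraphs.  The order of the two endpoints of an edge
   carries no meaning: it only fixes which end of the segment is the
   coordinate 0. *)
Record mgraph := MGraph {
  node : finType;
  edge : finType;
  src : edge -> node;
  tgt : edge -> node
}.

(* A traversal of an edge: [(e, false)] goes from [src e] to [tgt e], and
   [(e, true)] goes the other way. *)
Definition dart (G : mgraph) : finType := (edge G * bool)%type.

Definition dsrc (G : mgraph) (d : dart G) : node G :=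
  if d.2 then tgt d.1 else src d.1.

Definition dtgt (G : mgraph) (d : dart G) : node G :=
  if d.2 then src d.1 else tgt d.1.

Definition connected_graph (G : mgraph) : Prop :=
  forall u v : node G,
    connect (fun x y => [exists d : dart G, (dsrc d == x) && (dtgt d == y)]) u v.

Definition simple_graph (G : mgraph) : Prop :=
  (forall e : edge G, src e != tgt e) /\
  (forall e f : edge G,
     [set src e; tgt e]%SET = [set src f; tgt f]%SET -> e = f).

Definition total_length (R : realType) (G : mgraph) (len : edge G -> R)
  (F : {set edge G}) : R := \sum_(e in F) len e.

(* A closed walk with n.+1 steps, given by its steps (in a simple graph these
   are determined by the successive nodes); it starts at the source of its
   first step, and [cycle] includes the return from the last step. *)
Definition closed_walk (G : mgraph) (n : nat) (w : n.+1.-tuple (dart G)) : Prop :=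
  cycle (fun d d' : dart G => dtgt d == dsrc d') w.

Definition traversals (G : mgraph) (n : nat) (w : n.+1.-tuple (dart G))
  (e : edge G) : nat := count (fun d : dart G => d.1 == e) w.

Definition is_route (G : mgraph) (n : nat) (w : n.+1.-tuple (dart G)) : Prop :=
  closed_walk w /\ forall e : edge G, (1 <= traversals w e <= 2)%N.

Definition eulerian_cycle (G : mgraph) (n : nat) (w : n.+1.-tuple (dart G)) :
  Prop := closed_walk w /\ forall e : edge G, traversals w e = 1%N.

Definition duplicate (G : mgraph) : mgraph :=
  @MGraph (node G) (edge G * bool)%type (fun e => src e.1) (fun e => tgt e.1).

Definition unduplicate (G : mgraph) (d : dart (duplicate G)) : dart G :=
  (d.1.1, d.2).

Definition routes_F2 (G : mgraph) (n : nat) (w : n.+1.-tuple (dart G)) : Prop :=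
  exists c : n.+1.-tuple (dart (duplicate G)),
    eulerian_cycle c /\ w = map_tuple (@unduplicate G) c.

(* Moving along the edges at unit speed, without halting and without turning
   inside an edge: the bi-infinite sequence of the edge traversals, together
   with the time at which traversal number 0 starts.  The past is part of the
   policy, so that ages are defined from time 0 on. *)
Record policy (R : realType) (G : mgraph) := Policy {
  step : int -> dart G;
  origin : R
}.

(* The time at which traversal number k starts. *)
Definition departure (R : realType) (G : mgraph) (len : edge G -> R)
  (psi : policy R G) (k : int) : R :=
  match k with
  | Posz n => origin psi + \sum_(i < n) len (step psi (Posz i)).1
  | Negz n => origin psi - \sum_(i < n.+1) len (step psi (Negz i)).1
  end.

(* The point of the edge e at distance y from [src e] is visited at time s.
   Only the traversals of e itself count, which is exact inside the edge; the
   nodes form a null set. *)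
Definition visited (R : realType) (G : mgraph) (len : edge G -> R)
  (psi : policy R G) (e : edge G) (y s : R) : Prop :=
  exists k : int,
    [/\ departure len psi k <= s <= departure len psi (k + 1),
        (step psi k).1 = e &
        y = if (step psi k).2 then len e - (s - departure len psi k)
            else s - departure len psi k].

(* -oo if the point has never been visited. *)
Definition last_visit (R : realType) (G : mgraph) (len : edge G -> R)
  (psi : policy R G) (e : edge G) (y t : R) : \bar R :=
  ereal_sup [set s%:E | s in [set s : R | s <= t /\ visited len psi e y s]].

Definition age (R : realType) (G : mgraph) (len : edge G -> R)
  (psi : policy R G) (e : edge G) (y t : R) : \bar R :=
  (t%:E - last_visit len psi e y t)%E.

Definition age_finite_ae (R : realType) (G : mgraph) (len : edge G -> R)
  (psi : policy R G) : Prop :=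
  forall t : R, 0 <= t -> forall e : edge G,
    (@lebesgue_measure R).-negligible
      [set y : R | 0 <= y <= len e /\ age len psi e y t = +oo%E].

Definition policies_F (R : realType) (G : mgraph) (len : edge G -> R) :
  set (policy R G) :=
  [set psi |
    [/\ forall k : int, dtgt (step psi k) = dsrc (step psi (k + 1)),
        forall e : edge G, exists k : int, (step psi k).1 = e &
        age_finite_ae len psi]].

(* The policy that repeats the closed walk w, and is at its first node at
   time 0. *)
Definition repeat_walk (R : realType) (G : mgraph) (n : nat)
  (w : n.+1.-tuple (dart G)) : policy R G :=
  Policy (fun k : int => tnth w (inord `|(k %% n.+1%:Z)%Z|%N)) (0 : R).

Definition policies_F1 (R : realType) (G : mgraph) : set (policy R G) :=
  [set psi | exists (n : nat) (w : n.+1.-tuple (dart G)),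
     is_route w /\ psi = repeat_walk R w].

Definition mean_age (R : realType) (G : mgraph) (len : edge G -> R)
  (psi : policy R G) (T : R) : \bar R :=
  ((T^-1)%:E *
   \int[@lebesgue_measure R]_(t in `[0%R, T])
     \sum_(e : edge G)
       \int[@lebesgue_measure R]_(y in `[0%R, len e]) age len psi e y t)%E.

(* [AoI] is meaningful only when [AoI_exists]; the value +oo is allowed. *)
Definition AoI_exists (R : realType) (G : mgraph) (len : edge G -> R)
  (psi : policy R G) : Prop :=
  cvg (mean_age len psi T @[T --> +oo]).

Definition AoI (R : realType) (G : mgraph) (len : edge G -> R)
  (psi : policy R G) : \bar R :=
  lim (mean_age len psi T @[T --> +oo]).

Definition optimal (R : realType) (G : mgraph) (len : edge G -> R)
  (S : set (policy R G)) (psi : policy R G) : Prop :=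
  [/\ S psi, AoI_exists len psi &
      forall psi' : policy R G, S psi' -> AoI_exists len psi' ->
        (AoI len psi <= AoI len psi')%E].

Definition once_traversed (G : mgraph) (n : nat) (w : n.+1.-tuple (dart G)) :
  {set edge G} := [set e | traversals w e == 1%N]%SET.

(* Main.v *)
(* At any time t the points visited during the last a units of time cover a
   length at most a, so the set of points of age below a has length at most a;
   by the layer-cake formula the ages at time t then integrate to at least
   L^2/2 over the graph, for every policy.  For a periodic policy of period P,
   a point visited m times per period has age below a during at most m a units
   of time per period, so its age integrates to at least P^2/(2m) over a
   period, and a single visit gives the upper bound P^2/2.  A route of the
   duplicated scheme has P = 2L, hence AoI at most L^2; a route traversing
   length L1 once has P = 2L - L1, hence AoI at least
   P (L1/2 + (L - L1)/4) = L^2/2 + L1 (L - L1)/4. *)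
Require Import Defs.
From HB Require Import structures.
From mathcomp Require Import all_boot all_order all_algebra.
From mathcomp Require Import all_classical all_reals all_analysis.
From mathcomp Require Import measurable_realfun ring lra zify.
Import Order.TTheory GRing.Theory Num.Theory.
Import numFieldNormedType.Exports.
Local Open Scope classical_set_scope.
Local Open Scope ring_scope.

Set Implicit Arguments.
Unset Strict Implicit.
Unset Printing Implicit Defensive.

(** * The layer-cake lower bound *)

Lemma staircase_le (R : realType) (h y : R) (N : nat) : 0 <= h -> 0 <= y ->
  \sum_(j < N) h * (if j.+1%:R * h <= y then 1 else 0) <= y.
Proof.
move=> h0 y0; elim: N => [|N IH]; first by rewrite big_ord0.
(* If the highest threshold is reached, all N + 1 terms are at most h and their sum is at most (N +
   1) h; otherwise the last term vanishes and induction applies. *)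
have [Ny|Ny] := leP (N.+1%:R * h) y.
- apply: le_trans Ny; rewrite mulr_natl -[X in _ *+ X]card_ord -sumr_const.
  by apply: ler_sum => j _; rewrite ler_piMr//; case: ifP.
- by rewrite big_ord_recr/= (lt_geF Ny) mulr0 addr0.
Qed.

(** The superlevel sets above a have total measure at least A - c a, and integrating this over a in
    [0, A / c] gives the bound. The finite family of domains serves twice: all the edges at a fixed
    time, or a single time interval at a fixed point. *)
Lemma layer_cake_lower (R : realType) d (T : measurableType d)
  (mu : {measure set T -> \bar R}) (I : finType) (D : I -> set T)
  (g : I -> T -> \bar R) (A c : R) :
  (forall i, measurable (D i)) -> (forall i, measurable_fun [set: T] (g i)) ->
  (forall i x, (0 <= g i x)%E) ->
  0 <= A -> 0 < c -> (\sum_i mu (D i))%E = A%:E ->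
  (forall a : R, 0 <= a -> c * a <= A ->
     (\sum_i mu (D i `&` [set x | g i x < a%:E])%E <= (c * a)%:E)%E) ->
  ((A ^+ 2 / (2 * c))%:E <= \sum_i \int[mu]_(x in D i) g i x)%E.
Proof.
move=> mD mg g0 A0 c0 sumD small.
have mlt i a : measurable [set x | (g i x < a%:E)%E].
  rewrite -[X in measurable X]setTI.
  exact: (emeasurable_fun_infty_o measurableT (mg i)).
have mge i a : measurable [set x | (a%:E <= g i x)%E].
  rewrite -[X in measurable X]setTI.
  exact: (emeasurable_fun_c_infty measurableT (mg i)).
have fD i : (mu (D i) < +oo)%E.
  apply: (@le_lt_trans _ _ A%:E); last exact: ltry.
  by rewrite -sumD (bigD1 i)//= leeDl// sume_ge0.
have flt i a : mu (D i `&` [set x | (g i x < a%:E)%E]) \is a fin_num.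
  rewrite ge0_fin_numE//; apply: le_lt_trans (fD i).
  by apply: le_measure; rewrite ?inE//; exact: measurableI.
pose m i := fine (mu (D i)).
pose phi i a := fine (mu (D i `&` [set x | (g i x < a%:E)%E])).
have sumphi a : 0 <= a -> c * a <= A -> \sum_i phi i a <= c * a.
  move=> a0 aA; rewrite -lee_fin -sumEFin; apply: le_trans (small a a0 aA).
  by apply: lee_sum => i _; rewrite fineK.
have summ : \sum_i m i = A.
  apply: EFin_inj; rewrite -sumEFin -sumD; apply: eq_bigr => i _.
  by rewrite fineK// ge0_fin_numE.
(* As [D i] has finite measure, a bound on a sublevel set becomes one on its complement in [D i]. *)
have geE i a : mu ([set x | (a%:E <= g i x)%E] `&` D i) = (m i - phi i a)%:E.
  rewrite EFinB !fineK// ?ge0_fin_numE//.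
  rewrite [X in mu X](_ : _ = D i `\` (D i `&` [set x | (g i x < a%:E)%E])).
    by rewrite measureD ?setIA ?setIid//; [exact: measurableI|exact: fD].
  apply/seteqP; split => x /=.
    by move=> [ga Dx]; split => // -[_]; rewrite ltNge ga.
  by move=> [Dx H]; split => //; rewrite leNgt; apply/negP => ga; apply: H.
(* The staircase with steps h minorizes g, and integrates to a lower Riemann
   sum of [A - c a] over a in [0, A/c]. *)
have intge i h : 0 <= h -> forall N : nat,
    ((\sum_(j < N) h * (m i - phi i (j.+1%:R * h)))%:E
     <= \int[mu]_(x in D i) g i x)%E.
  move=> h0 N.
  pose s (j : nat) x : \bar R :=
    (h%:E * (\1_[set x | ((j.+1%:R * h)%:E <= g i x)%E] x)%:E)%E.
  have m1 j : measurable_fun (D i)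
      (fun x => (\1_[set x | ((j.+1%:R * h)%:E <= g i x)%E] x)%:E : \bar R).
    by apply/measurable_EFinP; exact: measurable_indic.
  have ms j : measurable_fun (D i) (s j) by apply: measurable_funeM.
  have s0 j x : (0 <= s j x)%E by rewrite mule_ge0// lee_fin.
  apply: (@le_trans _ _ (\int[mu]_(x in D i) \sum_(j < N) s j x)%E).
    rewrite ge0_integral_sum// -sumEFin; apply: lee_sum => j _.
    by rewrite EFinM -geE ge0_integralZl// ?integral_indic.
  apply: ge0_le_integral => //.
  - by move=> x _; apply: sume_ge0.
  - by apply: emeasurable_sum.
  - exact: measurable_funS (mg i).
  - move=> x Dx; have := g0 i x; rewrite /s.
    case gE : (g i x) => [y| |] y0; [|by rewrite leey|by []].
    have := @staircase_le R h y N h0; rewrite lee_fin in y0 => /(_ y0).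
    rewrite -lee_fin -sumEFin; apply: le_trans; apply: lee_sum => j _.
    rewrite indicE EFinM; case: ifPn => H; first by rewrite mem_set//= gE.
    by rewrite memNset//= gE lee_fin; apply/negP.
(* With N + 1 steps of height A / (c (N + 1)) the lower Riemann sum is the target times 1 - 1 / (N +
   1), and N tends to infinity. *)
suff H (N : nat) : ((A ^+ 2 / (2 * c) * (1 - N.+1%:R^-1))%:E
    <= \sum_i \int[mu]_(x in D i) g i x)%E.
  have: (A ^+ 2 / (2 * c) * (1 - n.+1%:R^-1))%:E @[n --> \oo]
      --> (A ^+ 2 / (2 * c) * (1 - 0))%:E.
    apply: cvg_EFin; first by near=> n.
    apply: cvgMr; apply: cvgB; first exact: cvg_cst.
    exact: cvg_harmonic.
  rewrite subr0 mulr1 => cv.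
  rewrite -(cvg_lim _ cv)//; apply: lime_le.
    by apply/cvg_ex; eexists; exact: cv.
  by near=> n; exact: H.
have n0 : N.+1%:R != 0 :> R by rewrite pnatr_eq0.
pose h := A / c / N.+1%:R.
have h0 : 0 <= h by rewrite !divr_ge0// ltW.
apply: le_trans (lee_sum _ (fun i _ => intge i h h0 N.+1)).
rewrite sumEFin lee_fin exchange_big/=.
apply: (@le_trans _ _ (\sum_(j < N.+1) h * (A - c * (j.+1%:R * h)))); last first.
  apply: ler_sum => j _.
  rewrite -mulr_sumr ler_wpM2l// big_split/= sumrN summ lerD2l lerN2.
  apply: sumphi; first by rewrite mulr_ge0.
  rewrite [leLHS](_ : _ = A * (j.+1%:R / N.+1%:R)).
    by rewrite ler_piMr// ler_pdivrMr ?mul1r ?ler_nat.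
  by rewrite /h; move: N.+1%:R n0 => n n0; field; rewrite n0 gt_eqF.
have sumj (n : nat) : \sum_(j < n) h * (A - c * (j.+1%:R * h))
    = h * n%:R * A - c * h ^+ 2 * (n%:R * (n%:R + 1)) / 2.
  elim: n => [|n IH]; first by rewrite big_ord0; field.
  by rewrite big_ord_recr/= IH -natr1; field.
rewrite sumj /h le_eqVlt; apply/orP; left; apply/eqP.
by move: N.+1%:R n0 => n n0; field; rewrite n0 gt_eqF.
Unshelve. all: by end_near. Qed.

(** A supremum exceeds x exactly when some member does, so its strict superlevel sets are countable
    unions. The index set will be [int], numbering the traversals. *)
Lemma measurable_fun_ereal_sup (R : realType) d (T : measurableType d)
  (I : countType) (f : I -> T -> \bar R) :
  (forall i, measurable_fun [set: T] (f i)) ->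
  measurable_fun [set: T] (fun x => ereal_sup (range (f ^~ x))).
Proof.
move=> mf mD; apply: (measurability _ (ErealGenOInfty.measurableE R)) => //.
move=> _ [_ [x ->] <-]; rewrite setTI.
rewrite [X in measurable X](_ : _ =
    \bigcup_(i : I) [set z | (x%:E < f i z)%E]); last first.
  apply/seteqP; split => z /=; rewrite in_itv/= andbT.
    by move=> /ereal_sup_gt[_ [i _ <-]] ?; exists i.
  by move=> [i _ /= xi]; apply: (lt_le_trans xi); apply: ereal_sup_ubound; exists i.
apply: countable_bigcupT_measurable => [|i]; first exact: countableP.
rewrite -[X in measurable X]setTI.
exact: (emeasurable_fun_o_infty measurableT (mf i)).
Qed.

(** * Passage times and ages *)

Section policy_theory.
Context (R : realType) (G : mgraph) (len : edge G -> R) (psi : policy R G).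
Implicit Types (k : int) (e : edge G) (y t s a : R).

Lemma departureS k :
  departure len psi (k + 1) = departure len psi k + len (step psi k).1.
Proof.
(* The clauses of [departure] meet at k = -1, that is [Negz 0], whose successor lies in the other
   clause. *)
case: k => [n|[|n]].
- by rewrite -PoszD addn1 /= big_ord_recr/= addrA.
- rewrite (_ : Negz 0 + 1 = Posz 0)//= big_ord0 big_ord_recr/= big_ord0; ring.
- rewrite (_ : Negz n.+1 + 1 = Negz n); last by rewrite !NegzE; lia.
  by rewrite /= [in RHS]big_ord_recr/=; ring.
Qed.

(* The time at which traversal k reaches the coordinate y of its edge. *)
Definition passage k y : R := departure len psi k +
  if (step psi k).2 then len (step psi k).1 - y else y.

(** At unit speed and without turning, a traversal meets each coordinate of its edge exactly once,
    so the visits to a point are indexed by traversals. *)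
Lemma visitedP e y s : 0 <= y <= len e -> visited len psi e y s <->
  exists k, (step psi k).1 = e /\ s = passage k y.
Proof.
move=> /andP[y0 ye]; rewrite /visited /passage; split.
  move=> [k [_ ek yk]]; exists k; split => //; rewrite ek.
  by case: ifP yk => _ yk; lra.
move=> [k [ek ->]]; exists k; rewrite departureS ek; split => //.
  by case: ifP => _; lra.
by case: (step psi k).2; ring.
Qed.

Lemma passage_itv e k y : 0 <= y <= len e -> (step psi k).1 = e ->
  departure len psi k <= passage k y <= departure len psi (k + 1).
Proof. by move=> ye ek; rewrite departureS /passage ek; case: ifP => _; lra. Qed.

(** The default [-oo] is neutral for suprema, so the supremum can range over all of [int] whatever
    e, y and t are, as measurability requires. *)
Definition visit_before e k y t : \bar R :=
  if ((step psi k).1 == e) && (passage k y <= t) then (passage k y)%:E else -oo%E.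

(* Unlike [age], this is nonnegative and jointly measurable in (y, t) on the
   whole plane; the two agree for y on the edge e. *)
Definition passage_age e y t : \bar R :=
  (t%:E - ereal_sup (range (fun k => visit_before e k y t)))%E.

Lemma ageE e y t : 0 <= y <= len e -> age len psi e y t = passage_age e y t.
Proof.
move=> ye; congr (_ - _)%E; apply/eqP; rewrite eq_le; apply/andP; split.
  apply: ge_ereal_sup => _ [s [st /(visitedP _ ye)[k [ek sk]]] <-].
  apply: ereal_sup_ubound; exists k => //.
  by rewrite /visit_before ek eqxx -sk st.
apply: ge_ereal_sup => _ [k _ <-]; rewrite /visit_before.
case: ifPn => [/andP[/eqP ek kt]|_]; last by rewrite leNye.
apply: ereal_sup_ubound; exists (passage k y) => //; split => //.
by apply/visitedP => //; exists k.
Qed.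

Lemma passage_age_ge0 e y t : (0 <= passage_age e y t)%E.
Proof.
rewrite sube_ge0 ?orbT//; apply: ge_ereal_sup => _ [k _ <-]; rewrite /visit_before.
by case: ifPn => [/andP[_]|_]; rewrite ?lee_fin ?leNye.
Qed.

Lemma passage_age_le e k y t : (step psi k).1 = e -> passage k y <= t ->
  (passage_age e y t <= (t - passage k y)%:E)%E.
Proof.
move=> ek kt; rewrite EFinB leeB//; apply: ereal_sup_ubound; exists k => //.
by rewrite /visit_before ek eqxx kt.
Qed.

(** A supremum above t - a has a member above t - a, whether or not it is attained. *)
Lemma passage_age_lt e y t a : (passage_age e y t < a%:E)%E ->
  exists k, (step psi k).1 = e /\ t - a < passage k y <= t.
Proof.
move=> lta; have /ereal_sup_gt[_ [k _ <-]] :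
    ((t - a)%:E < ereal_sup (range (fun k => visit_before e k y t)))%E.
  rewrite ltNge; apply/negP => H; move: lta; rewrite ltNge.
  suff -> : (a%:E <= passage_age e y t)%E by [].
  by have := leeB (lexx t%:E) H; rewrite -EFinB opprB addrCA subrr addr0.
rewrite /visit_before; case: ifPn => [/andP[/eqP ek kt]|//].
by rewrite lte_fin => ak; exists k; rewrite ak.
Qed.

Lemma measurable_passage k : measurable_fun [set: R] (passage k).
Proof.
apply: measurable_funD => //; case: (step psi k).2 => //.
exact: measurable_funB.
Qed.

Lemma measurable_passage_age e :
  measurable_fun [set: R * R] (fun z => passage_age e z.1 z.2).
Proof.
apply: emeasurable_funB; first by apply/measurable_EFinP.
apply: measurable_fun_ereal_sup => k; rewrite /visit_before.
have mp : measurable_fun [set: R * R] (fun z => passage k z.1).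
  exact: measurableT_comp (measurable_passage k) _.
apply: measurable_fun_ifT => //; last by apply/measurable_EFinP.
apply: measurable_and => //; exact: measurable_fun_ler.
Qed.

Lemma measurable_passage_age1 e t :
  measurable_fun [set: R] (fun y => passage_age e y t).
Proof.
exact: (measurableT_comp (measurable_passage_age e) (pair2_measurable t)).
Qed.

Lemma measurable_passage_age2 e y :
  measurable_fun [set: R] (passage_age e y).
Proof.
exact: (measurableT_comp (measurable_passage_age e) (pair1_measurable y)).
Qed.

End policy_theory.

(** * The lower bound for arbitrary policies *)

Section length_bounds.
Context (R : realType) (G : mgraph) (len : edge G -> R) (psi : policy R G).
Context (len_gt0 : forall e, 0 < len e).
Implicit Types (k : int) (e : edge G) (y t s a : R).
Local Notation mu := (@lebesgue_measure R).
Local Notation dep := (departure len psi).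

Lemma departure_homo : {homo dep : k l / k <= l >-> k <= l}.
Proof.
move=> k l kl; have [n ->] : exists n : nat, l = k + n%:Z by exists `|l - k|%N; lia.
elim: n {kl} => [|n IH]; first by rewrite addr0.
by rewrite -addn1 PoszD addrA departureS (le_trans IH)// lerDl ltW.
Qed.

(** Finitely many positive lengths have a positive lower bound [delta], so departure times grow at
    least linearly in both directions and a bounded time window meets finitely many traversals. *)
Lemma departure_cover a b :
  exists (m : int) (N : nat), dep m <= a /\ b < dep (m + N%:Z).
Proof.
pose delta := \big[Num.min/1]_e len e.
have d0 : 0 < delta by apply: lt_bigmin.
have dlen e : delta <= len e by exact: bigmin_le.
have lin k (n : nat) : dep k + n%:R * delta <= dep (k + n%:Z).
  elim: n => [|n IH]; first by rewrite mul0r !addr0.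
  rewrite -addn1 PoszD addrA departureS natrD mulrDl mul1r addrA.
  exact: lerD.
have arch x : exists n : nat, x < n%:R * delta.
  exists (Num.bound `|x / delta|); rewrite -ltr_pdivrMr//.
  by rewrite (le_lt_trans (ler_norm _))// archi_boundP.
have [n0 n0P] := arch (dep 0 - a).
have [N NP] := arch (b - dep (- n0%:Z)).
exists (- n0%:Z), N; split.
  by have := lin (- n0%:Z) n0; rewrite addNr; lra.
by have := lin (- n0%:Z) N; lra.
Qed.

Lemma recently_visited_measure t a : 0 <= a ->
  (\sum_e mu (`[0%R, len e] `&` [set y | passage_age len psi e y t < a%:E])%E
    <= a%:E)%E.
Proof.
move=> a0; have [m [N [mt Nt]]] := departure_cover (t - a) t.
(* Clamping to the window [t - a, t] makes the difference of consecutive clamped departures the time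
   a traversal spends in the window, 0 if it lies outside. *)
pose clamp x : R := Num.max (t - a) (Num.min x t).
have clampE x : t - a <= x <= t -> clamp x = x.
  by move=> /andP[x1 x2]; rewrite /clamp min_l// max_r.
have clamp_le x x' : x <= x' -> clamp x <= clamp x'.
  by move=> xx'; rewrite /clamp ge_max !le_max !lexx/= le_min !ge_min !lexx xx' !orbT.
pose cdep (i : nat) := clamp (dep (m + i%:Z)).
(* The coordinates that traversal k meets during the window: at time s it is at s - [dep k] going
   forwards and at [dep (k + 1)] - s going backwards. *)
pose J k := if (step psi k).2
  then `[dep (k + 1) - clamp (dep (k + 1)), dep (k + 1) - clamp (dep k)]
  else `[clamp (dep k) - dep k, clamp (dep (k + 1)) - dep k].
have muJ k : mu [set` J k] = (clamp (dep (k + 1)) - clamp (dep k))%:E.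
  have := clamp_le _ _ (departure_homo (_ : k <= k + 1)).
  rewrite lerDl ler01 => /(_ isT) c.
  rewrite /J; case: ifP => _; rewrite lebesgue_measure_itv/= lte_fin;
    case: ltP => h; rewrite -?EFinB; congr (_%:E); lra.
pose F e (i : nat) : set R :=
  if (step psi (m + i%:Z)).1 == e then [set` J (m + i%:Z)] else set0.
apply: (@le_trans _ _ (\sum_e \sum_(i < N) mu (F e i))%E).
  apply: lee_sum => e _; apply: content_subadditive.
  - by move=> k _; rewrite /F; case: ifP => _.
  - apply: measurableI => //; rewrite -[X in measurable X]setTI.
    apply: emeasurable_fun_infty_o => //.
    exact: measurable_passage_age1.
  - move=> y [/=]; rewrite in_itv/= => ye /passage_age_lt[k [ek kt]].
    have kdep : dep k <= passage len psi k y <= dep (k + 1).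
      exact: passage_itv ye ek.
    have mk : m <= k.
      rewrite leNgt; apply/negP => km.
      have /departure_homo : k + 1 <= m by rewrite lezD1.
      lra.
    have kN : k < m + N%:Z.
      by rewrite ltNge; apply/negP => /departure_homo; lra.
    rewrite -bigcup_mkord; have km0 : 0 <= k - m by rewrite subr_ge0.
    exists `|k - m|%N => /=; first by rewrite -ltz_nat gez0_abs// ltrBlDl.
    rewrite /F gez0_abs// subrKC ek eqxx.
    have [c1 c2] : clamp (dep k) <= passage len psi k y /\
       passage len psi k y <= clamp (dep (k + 1)).
      rewrite -{1}(clampE (passage len psi k y)); last lra.
      rewrite -{2}(clampE (passage len psi k y)); last lra.
      by split; apply: clamp_le; case/andP: kdep.
    move: c1 c2; rewrite /J /passage ek departureS ek.
    by case: ifP => _; rewrite /= in_itv/=; lra.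
(* Each traversal contributes to its own edge only, so the lengths telescope from t - a, the clamped
   value of [dep m], to t, that of [dep (m + N)]. *)
rewrite exchange_big/=.
rewrite (eq_bigr (fun i : 'I_N => (cdep i.+1 - cdep i)%:E)).
  rewrite sumEFin lee_fin -(big_mkord xpredT (fun i => cdep i.+1 - cdep i)).
  rewrite telescope_sumr// /cdep addr0 /clamp (min_r (ltW Nt)).
  rewrite (min_l (_ : dep m <= t)); last lra.
  rewrite (max_r (_ : t - a <= t)) ?(max_l mt); last lra.
  lra.
move=> i _; rewrite (bigD1 (step psi (m + i%:Z)).1)//= /F eqxx muJ.
rewrite big1 ?adde0; last by move=> e /negbTE ne; rewrite eq_sym ne measure0.
by rewrite /cdep -addrA -PoszD addn1.
Qed.

Lemma total_age_ge t :
  ((total_length len [set: edge G]%SET ^+ 2 / 2)%:E <=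
   \sum_e \int[mu]_(y in `[0%R, len e]) age len psi e y t)%E.
Proof.
under eq_bigr => e _ do (under eq_integral => y do
  (rewrite inE /= in_itv /= => ye; rewrite ageE//; over)).
(* The factor 1 is the rate c of the layer-cake bound: at most one unit of length is refreshed per
   unit of time. *)
rewrite [X in (X%:E <= _)%E](_ : _ =
  total_length len [set: edge G]%SET ^+ 2 / (2 * 1)); last by rewrite mulr1.
apply: layer_cake_lower => //.
- by move=> e; exact: measurable_passage_age1.
- by move=> e y; exact: passage_age_ge0.
- by apply: sumr_ge0 => e _; exact: ltW.
- rewrite /total_length -sumEFin [RHS]big_mkcond/=.
  apply: eq_bigr => e _; rewrite inE lebesgue_measure_itv/= lte_fin len_gt0.
  by rewrite sube0.
- by move=> a a0 _; rewrite mul1r; exact: recently_visited_measure.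
Qed.

End length_bounds.

(** * Means of periodic functions *)

Section periodic_mean.
Context (R : realType).
Implicit Types (f : R -> \bar R) (p c : R).
Local Notation mu := (@lebesgue_measure R).

Lemma measurable_translation p :
  measurable_fun [set: R] ((fun x => x + p) : _ -> measurableTypeR R).
Proof. exact: measurable_funD. Qed.

(** Translations preserve the lengths of half-open intervals, which determine Lebesgue measure. *)
Lemma lebesgue_measure_translation p (A : set R) : measurable A ->
  pushforward mu ((fun x => x + p) : _ -> measurableTypeR R) A = mu A.
Proof.
move=> mA; apply/esym/lebesgue_measure_unique => //=.
  exact: measurable_translation.
move=> ? _ [[a b]] _ <-; rewrite /pushforward.
rewrite (_ : _ @^-1` _ = `]a - p, b - p]%classic); last first.
  by apply/seteqP; split => x /=; rewrite !in_itv/=; lra.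
rewrite !lebesgue_measure_itv/= !lte_fin ltrD2r; case: ifP => // _.
by rewrite -!EFinD; congr (_%:E); ring.
Qed.

Lemma integral_periodic p f a b : measurable_fun [set: R] f ->
  (forall x, (0 <= f x)%E) -> (forall x, f (x + p) = f x) ->
  (\int[mu]_(x in `[(a + p)%R, (b + p)%R[) f x = \int[mu]_(x in `[a, b[) f x)%E.
Proof.
move=> mf f0 fp.
pose phi := (fun x => x + p) : _ -> measurableTypeR R.
transitivity (\int[mu]_(x in phi @^-1` `[(a + p)%R, (b + p)%R[) (f \o phi) x)%E.
  rewrite -ge0_integral_pushforward//=; last 2 first.
  - exact: measurable_translation.
  - exact: measurable_funS mf.
  by apply: eq_measure_integral => //= [|? A mA _];
    [exact: measurable_translation|exact/esym/lebesgue_measure_translation].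
rewrite (_ : phi @^-1` _ = `[a, b[%classic).
  by apply: eq_integral => x _; rewrite /= fp.
by apply/seteqP; split => x /=; rewrite !in_itv/= /phi; lra.
Qed.

(** If n full periods fit in [0, T], the integral lies between n c and (n + 1) c, so the mean is
    within c / T of c / p. *)
Lemma periodic_mean p c f : 0 < p -> measurable_fun [set: R] f ->
  (forall x, (0 <= f x)%E) -> (forall x, f (x + p) = f x) ->
  (\int[mu]_(x in `[0%R, p]) f x = c%:E)%E ->
  ((T^-1)%:E * \int[mu]_(x in `[0%R, T]) f x)%E @[T --> +oo] --> (c / p)%:E.
Proof.
move=> p0 mf f0 fp fc.
have oc a b : (\int[mu]_(x in `[a, b]) f x = \int[mu]_(x in `[a, b[) f x)%E.
  by rewrite integral_itv_bndo_bndc//; exact: measurable_funS mf.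
have c0 : 0 <= c by rewrite -lee_fin -fc integral_ge0.
have fn (n : nat) : (\int[mu]_(x in `[0%R, (n%:R * p)%R[) f x = (n%:R * c)%:E)%E.
  elim: n => [|n IH].
    by rewrite !mul0r set_itvco0 integral_set0.
  rewrite (@itv_bndbnd_setU _ _ _ (BLeft p)); last 2 first.
  - by rewrite bnd_simp ltW.
  - by rewrite bnd_simp ler_peMl ?ler1n// ltW.
  rewrite ge0_integral_setU//=; last 2 first.
  - exact: measurable_funS mf.
  - by apply/disj_setPS => x [/=]; rewrite !in_itv/=; lra.
  rewrite -oc fc -[X in `[X, _[](add0r p) -natr1 mulrDl mul1r.
  by rewrite integral_periodic// IH -EFinD; congr (_%:E); ring.
have bd T : 0 < T ->
    ((c / p - c * T^-1)%:E <= (T^-1)%:E * \int[mu]_(x in `[0%R, T]) f x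
     <= (c / p + c * T^-1)%:E)%E.
  move=> T0; have := truncn_itv (ltW (divr_gt0 T0 p0)).
  rewrite ler_pdivlMr// ltr_pdivrMr//; move: (Num.trunc _) => n /andP[nT Tn].
  rewrite oc lee_pdivlMl// lee_pdivrMl//.
  have lo : ((n%:R * c)%:E <= \int[mu]_(x in `[0%R, T[) f x)%E.
    rewrite -fn; apply: ge0_subset_integral => //; first exact: measurable_funS mf.
    by move=> x /=; rewrite !in_itv/=; lra.
  have hi : (\int[mu]_(x in `[0%R, T[) f x <= (n.+1%:R * c)%:E)%E.
    rewrite -fn; apply: ge0_subset_integral => //; first exact: measurable_funS mf.
    by move=> x /=; rewrite !in_itv/=; lra.
  have Tc : T * (c / p) = c * (T / p) by rewrite mulrCA.
  have TTc : T * (c * T^-1) = c by rewrite mulrCA divff ?mulr1 ?gt_eqF.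
  apply/andP; split.
    apply: le_trans lo; rewrite lee_fin mulrBr Tc TTc.
    rewrite lerBlDr -[leRHS](_ : c * n.+1%:R = _); last by rewrite -natr1; ring.
    by rewrite ler_wpM2l// ler_pdivrMr// ltW.
  apply: (le_trans hi); rewrite lee_fin mulrDr Tc TTc.
  rewrite -natr1 mulrDl mul1r lerD2r mulrC ler_wpM2l//.
  by rewrite ler_pdivlMr.
have V0 : T^-1 @[T --> +oo] --> (0 : R).
  apply/cvgrPdist_le => e e0; near=> T.
  have T0 : 0 < T by near: T; exact: nbhs_pinfty_gt.
  rewrite sub0r normrN ger0_norm ?invr_ge0 ?(ltW T0)//.
  rewrite invf_ple ?posrE//; near: T; apply: nbhs_pinfty_ge; exact: num_real.
apply: (@squeeze_cvge _ _ _ _ (fun T => (c / p - c * T^-1)%:E) _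
   (fun T => (c / p + c * T^-1)%:E)).
- by near=> T; apply: bd; near: T; exact: nbhs_pinfty_gt.
- rewrite -[X in X%:E](_ : c / p - c * 0 = _); last by rewrite mulr0 subr0.
  by apply: cvg_EFin; [near=> T|apply: cvgB; [exact: cvg_cst|exact: cvgMr]].
- rewrite -[X in X%:E](_ : c / p + c * 0 = _); last by rewrite mulr0 addr0.
  by apply: cvg_EFin; [near=> T|apply: cvgD; [exact: cvg_cst|exact: cvgMr]].
Unshelve. all: by end_near. Qed.

End periodic_mean.

(** * Exchanging the integrals over time and over an edge *)

Section fubini_restricted.
Context (R : realType).
Local Notation mu := (@lebesgue_measure R).
Context (D : set R) (g : R * R -> \bar R) (mD : measurable D)
  (mg : measurable_fun [set: R * R] g) (g0 : forall z, (0 <= g z)%E).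

Lemma measurable_integral_fst :
  measurable_fun [set: R] (fun t => \int[mu]_(y in D) g (y, t))%E.
Proof.
have -> : (fun t => \int[mu]_(y in D) g (y, t))%E = fubini_G mu (g \_ (D `*` setT)).
  apply/funext => t; rewrite integral_mkcond; apply: eq_integral => y _.
  by rewrite !patchE in_setX in_setT andbT.
apply: measurable_fun_fubini_tonelli_G.
  apply/(measurable_restrictT _ _).1; first exact: measurableX.
  exact: measurable_funS mg.
by move=> z; apply: erestrict_ge0.
Qed.

(** Extending g by 0 outside [D] x [E] reduces the exchange to Tonelli on the whole plane. *)
Lemma fubini_restricted (E : set R) : measurable E ->
  (\int[mu]_(t in E) \int[mu]_(y in D) g (y, t) =
   \int[mu]_(y in D) \int[mu]_(t in E) g (y, t))%E.
Proof.
move=> mE; pose h := g \_ (D `*` E).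
have mh : measurable_fun [set: R * R] h.
  apply/(measurable_restrictT _ _).1; first exact: measurableX.
  exact: measurable_funS mg.
have h0 z : (0 <= h z)%E by apply: erestrict_ge0.
transitivity (\int[mu]_t \int[mu]_y h (y, t))%E.
  rewrite integral_mkcond; apply: eq_integral => t _; rewrite patchE.
  case: ifPn => tE.
    rewrite integral_mkcond; apply: eq_integral => y _.
    by rewrite /h !patchE in_setX tE andbT.
  by rewrite integral0_eq// => y _; rewrite /h patchE in_setX (negbTE tE) andbF.
transitivity (\int[mu]_y \int[mu]_t h (y, t))%E.
  exact/esym/(@fubini_tonelli _ _ _ _ R mu mu h mh h0).
rewrite [in RHS]integral_mkcond; apply: eq_integral => y _; rewrite patchE.
case: ifPn => yD.
  rewrite [in RHS]integral_mkcond; apply: eq_integral => t _.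
  by rewrite /h !patchE in_setX yD.
by rewrite integral0_eq// => t _; rewrite /h patchE in_setX (negbTE yD).
Qed.

End fubini_restricted.

Lemma total_ageE (R : realType) (G : mgraph) (len : edge G -> R)
  (psi : policy R G) (t : R) :
  (\sum_e \int[lebesgue_measure]_(y in `[0%R, len e]) age len psi e y t =
   \sum_e \int[lebesgue_measure]_(y in `[0%R, len e])
     passage_age len psi e y t)%E.
Proof.
apply: eq_bigr => e _; apply: eq_integral => y; rewrite inE /= in_itv/= => ye.
exact: ageE.
Qed.

Lemma measurable_total_age (R : realType) (G : mgraph) (len : edge G -> R)
  (psi : policy R G) : measurable_fun [set: R] (fun t =>
    \sum_e \int[lebesgue_measure]_(y in `[0%R, len e]) age len psi e y t)%E.
Proof.
rewrite (funext (total_ageE len psi)).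
apply: emeasurable_sum => e.
apply: (@measurable_integral_fst R _ (fun z => passage_age len psi e z.1 z.2)).
- exact: measurable_itv.
- exact: measurable_passage_age.
- by move=> z; exact: passage_age_ge0.
Qed.

Lemma integral_itv_id (R : realType) (p : R) : 0 < p ->
  (\int[lebesgue_measure]_(t in `[0%R, p]) t%:E = (p ^+ 2 / 2)%:E)%E.
Proof.
move=> p0.
have der (x : R) : is_derive x 1 (fun t : R => t ^+ 2 / 2) x.
  have -> : (fun t : R => t ^+ 2 / 2) = (2^-1 : R) \*: (fun t : R => t ^+ 2).
    by apply/funext => t; rewrite /= mulrC.
  by apply: is_derive_eq; rewrite /GRing.scale/=; field.
have cont : continuous (fun t : R => t ^+ 2 / 2).
  by move=> x; apply/differentiable_continuous/derivable1_diffP; have [] := der x.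
rewrite (@continuous_FTC2 _ id (fun t => t ^+ 2 / 2))//.
- by rewrite -EFinB expr0n/= mul0r subr0.
- by apply: continuous_subspaceT => x; exact: cvg_id.
- split; first by move=> x _; have [] := der x.
  + exact/cvg_at_right_filter/cont.
  + exact/cvg_at_left_filter/cont.
- by move=> x _; rewrite derive1E (@derive_val _ _ _ _ _ _ _ (der x)).
Qed.

(** * Periodic policies *)

(* An arc of length a starting at s on a circle of length p, cut open at 0. *)
Lemma wrapped_itv_measure (R : realType) (s a p : R) :
  0 <= s <= p -> 0 <= a <= p ->
  (@lebesgue_measure R
     (`[s, Num.min (s + a)%R p[ `|` `[0%R, (s - p + a)%R[) <= a%:E)%E.
Proof.
move=> sp ap; apply: (@le_trans _ _ (lebesgue_measure `[s, Num.min (s + a)%R p[ +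
    lebesgue_measure `[0%R, (s - p + a)%R[)%E).
  exact: measureU2.
rewrite !lebesgue_measure_itv/= !lte_fin -!EFinB.
case: (leP (s + a) p) => h1; case: ltP => h2; case: ltP => h3;
  rewrite ?adde0 ?add0e -?EFinD lee_fin; lra.
Qed.

Section periodic_policy.
Context (R : realType) (G : mgraph) (len : edge G -> R).
Context (len_gt0 : forall e, 0 < len e).
Context (n : nat) (w : n.+1.-tuple (dart G)).
Implicit Types (k : int) (e : edge G) (y t s a : R).
Local Notation mu := (@lebesgue_measure R).
Local Notation psi := (repeat_walk R w).
Local Notation dep := (departure len psi).
Local Notation period := (\sum_(i < n.+1) len (tnth w i).1).

Lemma traversals_card e : traversals w e = #|[pred i | (tnth w i).1 == e]|.
Proof. by rewrite /traversals -sum1_count big_tuple -sum1_card. Qed.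

Lemma step_repeat (i : 'I_n.+1) : step psi i%:Z = tnth w i.
Proof.
rewrite /= modz_nat modn_small ?ltn_ord//.
by congr (tnth w _); apply/val_inj; rewrite /= inordK.
Qed.

Lemma step_periodic k : step psi (k + n.+1%:Z) = step psi k.
Proof. by rewrite /= modzDr. Qed.

Lemma departure_periodic k : dep (k + n.+1%:Z) = dep k + period.
Proof.
(* As an equivalence, this carries the identity from 0 both upwards and downwards. *)
have S j : dep (j + 1 + n.+1%:Z) = dep (j + 1) + period <->
           dep (j + n.+1%:Z) = dep j + period.
  rewrite addrAC !departureS step_periodic.
  by split => H; lra.
have H0 : dep (0 + n.+1%:Z) = dep 0 + period.
  rewrite !add0r /= big_ord0 addr0; congr (_ + _).
  by apply: eq_bigr => i _; exact: (congr1 (fun d => len d.1) (step_repeat i)).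
case: k => m.
  elim: m => [//|m IH]; have -> : Posz m.+1 = Posz m + 1 by lia.
  exact/(S m).
elim: m => [|m IH]; apply/(S (Negz _)); first by rewrite (_ : Negz 0 + 1 = 0).
by rewrite (_ : Negz m.+1 + 1 = Negz m)// !NegzE; lia.
Qed.

Lemma passage_periodic k y :
  passage len psi (k + n.+1%:Z) y = passage len psi k y + period.
Proof.
by rewrite /passage departure_periodic step_periodic addrAC.
Qed.

(** Shifting the index by one round permutes the traversals and delays each passage by one period,
    so the last visit moves along with t. *)
Lemma passage_age_periodic e y t :
  passage_age len psi e y (t + period) = passage_age len psi e y t.
Proof.
have visitP k : visit_before len psi e (k + n.+1%:Z) y (t + period) =
    (visit_before len psi e k y t + period%:E)%E.
  rewrite /visit_before passage_periodic lerD2r step_periodic.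
  by case: ifP.
rewrite /passage_age; set sup' := ereal_sup _; set sup := ereal_sup _.
have -> : sup' = (sup + period%:E)%E.
  apply/eqP; rewrite eq_le; apply/andP; split.
    apply: ge_ereal_sup => _ [k _ <-].
    rewrite -(subrK n.+1%:Z k) visitP leeD2r//.
    by apply: ereal_sup_ubound; exists (k - n.+1%:Z).
  rewrite -leeBrDr//; apply: ge_ereal_sup => _ [k _ <-].
  rewrite leeBrDr// -visitP.
  by apply: ereal_sup_ubound; exists (k + n.+1%:Z).
case: sup => [s| |] //=; rewrite -!EFinB; congr (_%:E); ring.
Qed.

Lemma period_gt0 : 0 < period.
Proof.
rewrite big_ord_recl ltr_wpDr//; apply: sumr_ge0 => i _; exact: ltW.
Qed.

Lemma departure0 : dep 0 = 0.
Proof. by rewrite /= big_ord0 addr0. Qed.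

Lemma departure_period : dep n.+1%:Z = period.
Proof. by rewrite -(add0r n.+1%:Z) departure_periodic departure0 add0r. Qed.

Lemma departure_Nperiod : dep (- n.+1%:Z) = - period.
Proof. by have := departure_periodic (- n.+1%:Z); rewrite addNr departure0; lra. Qed.

Lemma passage_first_period e y (i : 'I_n.+1) : 0 <= y <= len e ->
  (tnth w i).1 = e -> 0 <= passage len psi i%:Z y <= period.
Proof.
move=> ye; rewrite -step_repeat => ie.
have /andP[h1 h2] := passage_itv ye ie.
have : dep 0 <= dep i%:Z by apply: departure_homo.
have : dep (i%:Z + 1) <= dep n.+1%:Z.
  by apply: departure_homo => //; have := ltn_ord i; lia.
rewrite departure0 departure_period => h3 h4.
by rewrite (le_trans h4 h1) (le_trans h2 h3).
Qed.

(** A passage at tau and its copy one period earlier bound the age by t - tau from tau on and by t -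
    tau + P before, P being the period. This sawtooth integrates to P^2 / 2 - tau P + P tau,
    whatever tau is. *)
Lemma integral_age_period_le e y : 0 <= y <= len e -> (0 < traversals w e)%N ->
  (\int[mu]_(t in `[0%R, period]) passage_age len psi e y t <=
   (period ^+ 2 / 2)%:E)%E.
Proof.
move=> ye; rewrite /traversals -has_count => /hasP[d /tnthP[i ->] /eqP ie].
have tauP := passage_first_period ye ie.
have ie' : (step psi i%:Z).1 = e by rewrite step_repeat.
set tau := passage len psi i%:Z y in tauP.
have tauN : passage len psi (i%:Z - n.+1%:Z) y = tau - period.
  by have := passage_periodic (i%:Z - n.+1%:Z) y; rewrite subrK -/tau; lra.
have P0 := period_gt0.
have ieN : (step psi (i%:Z - n.+1%:Z)).1 = e.
  by rewrite -step_periodic subrK.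
have mage := @measurable_passage_age2 _ _ len psi e y.
have mind : measurable_fun (`[0%R, period]%classic : set R)
    (fun t => (period%:E * (\1_(`[0%R, tau[ : set R) t)%:E)%E : \bar R).
  by apply: measurable_funeM; apply/measurable_EFinP; exact: measurable_indic.
have mid : measurable_fun (`[0%R, period]%classic : set R) (EFin : R -> \bar R).
  exact/measurable_EFinP.
have bound t : t \in `[0, period] -> (passage_age len psi e y t + tau%:E <=
    t%:E + period%:E * (\1_(`[0%R, tau[ : set R) t)%:E)%E.
  rewrite in_itv/= => t01; rewrite -leeBrDr// indicE mem_setE.
  rewrite /= in_itv/=; have [tau_t|t_tau] := leP tau t.
    by rewrite andbF mule0 adde0; exact: passage_age_le ie' tau_t.
  rewrite andbT (_ : 0 <= t); last by case/andP: t01.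
  apply: le_trans (passage_age_le ieN (_ : _ <= t)) _; rewrite tauN; first lra.
  by rewrite mule1 -!EFinD lee_fin; lra.
have age0 := @passage_age_ge0 _ _ len psi e y.
move: (passage_age len psi e y) mage bound age0 => g mg bound g0.
(* Adding tau to both sides keeps all the integrands nonnegative. *)
have : (\int[mu]_(t in `[0%R, period]) (g t + tau%:E) <=
   \int[mu]_(t in `[0%R, period])
     (t%:E + period%:E * (\1_(`[0%R, tau[ : set R) t)%:E))%E.
  apply: ge0_le_integral => //.
  - by move=> t _; rewrite adde_ge0// lee_fin; lra.
  - by apply: emeasurable_funD => //; exact: measurable_funS mg.
  - exact: emeasurable_funD.
have measP : mu `[0%R, period] = period%:E.
  by rewrite lebesgue_measure_itv/= lte_fin P0 sube0.
have meast : mu `[0%R, tau[ = tau%:E.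
  rewrite lebesgue_measure_itv/= lte_fin; case: ltP => h; first by rewrite sube0.
  by congr (_%:E); lra.
rewrite ge0_integralD//; last 2 first.
- exact: measurable_funS mg.
- by move=> t _; rewrite lee_fin; lra.
rewrite ge0_integralD//; last 2 first.
- by move=> t /=; rewrite in_itv/= => /andP[].
- by move=> t _; rewrite mule_ge0// lee_fin ?ltW.
rewrite integral_cst//= measP integral_itv_id// ge0_integralZl//; last 2 first.
- by apply/measurable_EFinP; exact: measurable_indic.
- by rewrite lee_fin ltW.
rewrite integral_indic//= (setIidl _); last first.
  by move=> t /=; rewrite !in_itv/=; lra.
rewrite meast -!EFinM -EFinD -leeBrDr// => /le_trans; apply.
by rewrite -EFinB lee_fin (mulrC tau) addrK.
Qed.

Lemma integral_age_period_ge e y : 0 <= y <= len e -> (0 < traversals w e)%N ->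
  ((period ^+ 2 / (2 * (traversals w e)%:R))%:E <=
   \int[mu]_(t in `[0%R, period]) passage_age len psi e y t)%E.
Proof.
move=> ye w0; have P0 := period_gt0.
have mage := @measurable_passage_age2 _ _ len psi e y.
(* Without the end point of the period, passages of the next round cannot count. *)
rewrite -integral_itv_bndo_bndc; last exact: measurable_funS mage.
have := @layer_cake_lower R _ _ mu 'I_1 (fun=> `[0%R, period[%classic)
  (fun=> passage_age len psi e y) period (traversals w e)%:R.
rewrite !big_ord1; apply => //.
- by move=> _ t; exact: passage_age_ge0.
- exact: ltW.
- by rewrite ltr0n.
- by rewrite /= lebesgue_measure_itv/= lte_fin P0 sube0.
move=> a a0 aP; rewrite big_ord1.
(* Hence an age below a can only come from the current round or the one before. *)
have aP' : a <= period.
  by apply: le_trans aP; rewrite ler_peMl// ler1n.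
pose tau (i : nat) := passage len psi i%:Z y.
(* The times of the round at which step i makes the age small: just after its own passage, or at the
   start of the round because of its passage one round earlier. *)
pose F (i : nat) : set R := if (step psi i%:Z).1 == e then
    `[tau i, Num.min (tau i + a) period[ `|` `[0, tau i - period + a[ else set0.
apply: (@le_trans _ _ (\sum_(i < n.+1) mu (F i))%E).
  apply: content_subadditive.
  - by move=> i _; rewrite /F; case: ifP => _ //; exact: measurableU.
  - apply: measurableI => //; rewrite -[X in measurable X]setTI.
    exact: emeasurable_fun_infty_o.
  - move=> t [/=]; rewrite in_itv/= => tP /passage_age_lt[k [ek kt]].
    have /andP[h1 h2] := passage_itv ye ek.
    have kn : k < n.+1%:Z.
      rewrite ltNge; apply/negP => /(@departure_homo _ _ _ psi len_gt0).
      by rewrite departure_period; lra.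
    have nk : - n.+1%:Z <= k.
      rewrite leNgt; apply/negP => kn'.
      have /(@departure_homo _ _ _ psi len_gt0) : k + 1 <= - n.+1%:Z by rewrite lezD1.
      by rewrite departure_Nperiod; lra.
    rewrite -bigcup_mkord; have [k0|k0] := leP 0 k.
      exists `|k|%N => /=; first by rewrite -ltz_nat gez0_abs.
      rewrite /F /tau gez0_abs// ek eqxx; left.
      by rewrite /= in_itv/= lt_min; lra.
    have kn0 : 0 <= k + n.+1%:Z by rewrite -lerBlDr sub0r.
    exists `|(k + n.+1%:Z)%R|%N => /=.
      by rewrite -ltz_nat gez0_abs// gtrDr.
    rewrite /F /tau gez0_abs//.
    rewrite passage_periodic step_periodic ek eqxx; right.
    by rewrite /= in_itv/=; lra.
have -> : (traversals w e)%:R * a = \sum_(i < n.+1) (if (tnth w i).1 == e then a else 0).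
  by rewrite -[in RHS]big_mkcond/= sumr_const mulr_natl traversals_card.
rewrite -sumEFin; apply: lee_sum => i _; rewrite /F step_repeat.
case: ifPn => [/eqP ie|_]; last by rewrite measure0.
have tauP := passage_first_period ye ie.
rewrite -/(tau i) in tauP; by apply: wrapped_itv_measure => //; rewrite a0.
Qed.

Lemma period_traversals : period = \sum_e len e * (traversals w e)%:R.
Proof.
rewrite (partition_big (fun i => (tnth w i).1) predT)//=.
apply: eq_bigr => e _; rewrite traversals_card mulr_natr -sumr_const.
by apply: eq_bigr => i /eqP ->.
Qed.

(** The total age is periodic in time, so its mean converges to its average over one period;
    exchanging the integrals there reduces both bounds to a fixed point of an edge. The lower one
    will serve for the optimal route, the upper one for the duplicated scheme. *)
Lemma AoI_covering_walk : (forall e, 0 < traversals w e)%N ->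
  exists v : R, [/\ mean_age len psi T @[T --> +oo] --> v%:E,
    \sum_e len e * (period / (2 * (traversals w e)%:R)) <= v &
    v <= \sum_e len e * (period / 2)].
Proof.
move=> w0; have P0 := period_gt0.
pose g e (z : R * R) := passage_age len psi e z.1 z.2.
pose f t : \bar R := (\sum_e \int[mu]_(y in `[0%R, len e]) g e (y, t))%E.
have mg e : measurable_fun [set: R * R] (g e) by exact: measurable_passage_age.
have g0 e z : (0 <= g e z)%E by exact: passage_age_ge0.
have mi e : measurable_fun [set: R]
    (fun t => \int[mu]_(y in `[0%R, len e]) g e (y, t))%E.
  exact: measurable_integral_fst.
have i0 e t : (0 <= \int[mu]_(y in `[0%R, len e]) g e (y, t))%E.
  exact: integral_ge0.
have mf : measurable_fun [set: R] f by exact: emeasurable_sum.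
have f0 t : (0 <= f t)%E by exact: sume_ge0.
have fP t : f (t + period) = f t.
  apply: eq_bigr => e _; apply: eq_integral => y _.
  by rewrite /g/= passage_age_periodic.
have intf : (\int[mu]_(t in `[0%R, period]) f t = \sum_e
    \int[mu]_(y in `[0%R, len e]) \int[mu]_(t in `[0%R, period]) g e (y, t))%E.
  rewrite /f ge0_integral_sum; first last.
  - by move=> e t _; exact: i0.
  - move=> e; exact: measurable_funS (mi e).
  - exact: measurable_itv.
  apply: eq_bigr => e _.
  have := @fubini_restricted R `[0%R, len e]%classic (g e) (measurable_itv _).
  move=> /(_ (mg e) (g0 e)); apply; exact: measurable_itv.
have cst_len (e : edge G) (r : R) :
    (\int[mu]_(y in `[0%R, len e]) r%:E = (len e * r)%:E)%E.
  rewrite integral_cst//= lebesgue_measure_itv/= lte_fin len_gt0 sube0 -EFinM.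
  by rewrite mulrC.
have mgy e : measurable_fun (`[0%R, len e]%classic : set R)
    (fun y => \int[mu]_(t in `[0%R, period]) g e (y, t))%E.
  apply: (@measurable_funS _ _ _ _ [set: R]) => //.
  apply: (@measurable_integral_fst R _ (fun z => g e (z.2, z.1))).
  - exact: measurable_itv.
  - exact: measurableT_comp (mg e) (measurable_fun_pair measurable_snd measurable_fst).
  - by move=> z; exact: g0.
have upper : (\int[mu]_(t in `[0%R, period]) f t <=
    (\sum_e len e * (period ^+ 2 / 2))%:E)%E.
  rewrite intf -sumEFin; apply: lee_sum => e _; rewrite -cst_len.
  apply: ge0_le_integral => //; [by move=> y _; exact: integral_ge0|exact: mgy|].
  by move=> y /=; rewrite in_itv/= => ye; exact: integral_age_period_le.
have lower : ((\sum_e len e * (period ^+ 2 / (2 * (traversals w e)%:R)))%:E <=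
    \int[mu]_(t in `[0%R, period]) f t)%E.
  rewrite intf -sumEFin; apply: lee_sum => e _; rewrite -cst_len.
  apply: ge0_le_integral => //.
  - by move=> y _; rewrite lee_fin divr_ge0 ?sqr_ge0// mulr_ge0.
  - exact: mgy.
  by move=> y /=; rewrite in_itv/= => ye; exact: integral_age_period_ge.
(* The upper bound makes the integral over a period a real number, as [periodic_mean] requires. *)
have fin : (\int[mu]_(t in `[0%R, period]) f t)%E \is a fin_num.
  rewrite ge0_fin_numE; first exact: le_lt_trans upper (ltry _).
  exact: integral_ge0.
pose c := fine (\int[mu]_(t in `[0%R, period]) f t)%E.
have cE : (\int[mu]_(t in `[0%R, period]) f t)%E = c%:E by rewrite fineK.
move: upper lower; rewrite cE !lee_fin => upper lower.
have sq (l x : R) : l * (period / x) * period = l * (period ^+ 2 / x).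
  by rewrite -mulrA [_ / x * _]mulrAC expr2.
exists (c / period); split.
- by rewrite /mean_age (funext (total_ageE len psi)); exact: periodic_mean.
- rewrite ler_pdivlMr// mulr_suml; apply: le_trans lower; apply: ler_sum => e _.
  by rewrite sq.
- rewrite ler_pdivrMr// mulr_suml; apply: (le_trans upper).
  by apply: ler_sum => e _; rewrite sq.
Qed.

End periodic_policy.

(** * Comparison of the duplicated scheme with the optimal policies *)

Lemma mean_age_ge (R : realType) (G : mgraph) (len : edge G -> R)
  (psi : policy R G) (T : R) : (forall e, 0 < len e) -> 0 < T ->
  ((total_length len [set: edge G]%SET ^+ 2 / 2)%:E <= mean_age len psi T)%E.
Proof.
move=> len_gt0 T0; rewrite /mean_age lee_pdivlMl//.
set r := _ / 2.
have -> : (T%:E * r%:E)%E = (\int[@lebesgue_measure R]_(t in `[0%R, T]) r%:E)%E.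
  rewrite integral_cst//= lebesgue_measure_itv/= lte_fin T0 sube0.
  by rewrite muleC.
apply: ge0_le_integral => //.
- by move=> t _; rewrite lee_fin divr_ge0 ?sqr_ge0.
- by apply: measurable_funS (measurable_total_age len psi).
- by move=> t _; exact: total_age_ge.
Qed.

Lemma traversals_F2 (G : mgraph) (n : nat) (w : n.+1.-tuple (dart G)) e :
  routes_F2 w -> traversals w e = 2%N.
Proof.
move=> [c [[_ once] ->]]; rewrite /traversals count_map.
(* A traversal of e uses exactly one of its two copies, so the counts add up. *)
have split_copies (s : seq (dart (duplicate G))) :
    count (fun d => (unduplicate d).1 == e) s =
    (count (fun d => d.1 == (e, false)) s + count (fun d => d.1 == (e, true)) s)%N.
  elim: s => //= -[[f b] b'] s ->; rewrite /= !xpair_eqE.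
  by case: (f == e); case: b => /=; lia.
rewrite -[LHS]/(count (fun d => (unduplicate d).1 == e) c) split_copies.
by rewrite -!/(traversals c _) !once.
Qed.

Unset Implicit Arguments.

Theorem theorem1 (R : realType) (G : mgraph) (len : edge G -> R)
  (hconn : connected_graph G) (hsimple : simple_graph G)
  (hlen : forall e : edge G, 0 < len e)
  (n2 : nat) (R2 : n2.+1.-tuple (dart G)) (hR2 : routes_F2 R2) :
  [/\ AoI_exists len (repeat_walk R R2),
      forall (n1 : nat) (R1 : n1.+1.-tuple (dart G)),
        is_route R1 ->
        optimal len (@policies_F1 R G) (repeat_walk R R1) ->
        let L := total_length len [set: edge G]%SET in
        let L1 := total_length len (once_traversed R1) in
        let bound := L ^+ 2 / (1 / 2 * L ^+ 2 + 1 / 4 * (L1 * (L - L1))) in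
        (AoI len (repeat_walk R R2) / AoI len (repeat_walk R R1) <= bound%:E)%E
        /\ bound <= 2 &
      forall Rstar : policy R G,
        optimal len (policies_F len) Rstar ->
        (AoI len (repeat_walk R R2) / AoI len Rstar <= 2%:E)%E].
Proof.
set Ltot := total_length len [set: edge G]%SET.
have LE : Ltot = \sum_e len e by apply: eq_bigl => e; rewrite inE.
have L0 : 0 < Ltot.
  (* A walk has at least one step, whose edge has positive length. *)
  rewrite LE (bigD1 (thead R2).1)//= ltr_wpDr//; apply: sumr_ge0 => e _.
  exact: ltW.
have Lsq0 : 0 < Ltot ^+ 2 by rewrite exprn_gt0.
have trav2 e : traversals R2 e = 2%N by exact: traversals_F2.
have [|v2 [cv2 _ v2L]] := @AoI_covering_walk R G len hlen n2 R2.
  by move=> e; rewrite trav2.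
have AoI2 : AoI len (repeat_walk R R2) = v2%:E by exact/cvg_lim.
have {}v2L : v2 <= Ltot ^+ 2.
  apply: le_trans v2L _; rewrite -mulr_suml period_traversals.
  under [X in _ * (X / 2)]eq_bigr => e _ do rewrite trav2.
  by rewrite -mulr_suml mulfK ?pnatr_eq0// -LE expr2.
have half : 0 < Ltot ^+ 2 / 2 by rewrite divr_gt0.
split.
- by apply/cvg_ex; exists v2%:E.
- move=> n1 R1 [_ R1b] _ L L1 bound.
  have [|v1 [cv1 v1L _]] := @AoI_covering_walk R G len hlen n1 R1.
    by move=> e; case/andP: (R1b e).
  have AoI1 : AoI len (repeat_walk R R1) = v1%:E by exact/cvg_lim.
  have LLt : L = Ltot by [].
  pose L' := \sum_(e | e \notin once_traversed R1) len e.
  have LL : Ltot = L1 + L'.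
    by rewrite LE (bigID (fun e => e \in once_traversed R1)).
  have L10 : 0 <= L1 by apply: sumr_ge0 => e _; exact: ltW.
  have L'0 : 0 <= L' by apply: sumr_ge0 => e _; exact: ltW.
  (* On a route the multiplicity is 1 on the edges counted by [L1] and 2 on those counted by [L'];
     this evaluates both the period and the lower bound. *)
  have split_sum (F : nat -> R) :
      \sum_e len e * F (traversals R1 e) = L1 * F 1%N + L' * F 2%N.
    rewrite (bigID (fun e => e \in once_traversed R1))/= !mulr_suml.
    congr (_ + _); apply: eq_bigr => e; rewrite inE; first by move/eqP->.
    by move: (R1b e); case: (traversals R1 e) => [|[|[|]]].
  move: v1L; rewrite (split_sum (fun m => _ / (2 * m%:R))) period_traversals.
  rewrite (split_sum (fun m => m%:R)).
  set denom := 1 / 2 * L ^+ 2 + 1 / 4 * (L1 * (L - L1)) in bound *.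
  rewrite [X in X <= _ -> _](_ : _ = denom); last first.
    by rewrite /denom LLt LL; field.
  move=> v1L.
  (* This term makes [denom] at least half the squared total length, which bounds the ratio by 2. *)
  have LL1 : 0 <= L1 * (L - L1).
    by rewrite mulr_ge0// LLt LL addrAC subrr add0r.
  have dL : Ltot ^+ 2 / 2 <= denom by rewrite /denom LLt in LL1 *; lra.
  have d0 : 0 < denom by apply: lt_le_trans dL.
  (* Positivity avoids the special value of the extended inverse at 0. *)
  have v10 : 0 < v1 by apply: lt_le_trans v1L.
  split.
    rewrite AoI2 AoI1 inver gt_eqF// -EFinM lee_fin /bound.
    apply: (@le_trans _ _ (Ltot ^+ 2 / v1)).
      by rewrite ler_pM2r ?invr_gt0.
    by rewrite ler_pM2l// lef_pV2.
  by rewrite /bound ler_pdivrMr//; rewrite LLt; lra.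
- move=> Rstar [_ ex _].
  have lower : ((Ltot ^+ 2 / 2)%:E <= AoI len Rstar)%E.
    apply: lime_ge; first exact: ex.
    near=> T; apply: mean_age_ge; first exact: hlen.
    by near: T; exact: nbhs_pinfty_gt.
  rewrite AoI2; case: (AoI len Rstar) lower => [x| |//].
    rewrite lee_fin => Lx; have x0 : 0 < x by apply: lt_le_trans Lx.
    by rewrite inver gt_eqF// -EFinM lee_fin ler_pdivrMr//; lra.
  (* If the AoI of [Rstar] is [+oo], its inverse is 0 and so is the ratio. *)
  by move=> _; rewrite invey mule0 lee_fin.
Unshelve. all: by end_near. Qed.
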